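(* Let $\mathbb{F}_q$ be a finite field and let $a\in M_n(\mathbb{F}_q)$ be nilpotent. Then $$K_n(a)=K_n(0)=(-1)^nq^{n(n-1)/2}.$$
   Context: $\mathbb{F}_q$ is a finite field of characteristic $p$. The additive character $\varphi:\mathbb{F}_q\to\mathbb{C}^*$ is $\varphi(x)=\exp(2\pi i\,\mathrm{Tr}_{\mathbb{F}_q/\mathbb{F}_p}(x)/p)$, and $\psi=\varphi\circ\mathrm{tr}$ on $M_n(\mathbb{F}_q)$, where $\mathrm{tr}$ is the matrix trace. For $a\in M_n(\mathbb{F}_q)$, $K_n(a)=\sum_{x\in \mathrm{GL}_n(\mathbb{F}_q)}\psi(ax+x^{-1})$. *)

(* Defs.v *)
From HB Require Import structures.
From mathcomp Require Import all_boot all_order all_fingroup all_algebra.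
From mathcomp Require Import all_field.
From mathcomp Require Import reals sequences exp trigo.
From mathcomp Require Import complex.

Set Implicit Arguments.
Unset Strict Implicit.
Unset Printing Implicit Defensive.

Import Order.TTheory GRing.Theory Num.Theory.
Local Open Scope ring_scope.
Local Open Scope complex_scope.

Section AbsoluteTrace.
Variables (F : finFieldType) (p : nat) (pcharFp : p \in [pchar F]).

(* [pPrimeCharType pcharFp] is F regarded as an extension of 'F_p. *)
Let L : splittingFieldType 'F_p := pPrimeCharType pcharFp.

Definition trFp (x : F) : 'F_p :=
  odflt 0 [pick c : 'F_p | c%:A == galTrace 1 {:L} (x : L)].

Lemma trFpE (x : F) : (trFp x)%:A = galTrace 1 {:L} (x : L).
Proof.
have galL : galois 1 {:L}.
  exact: finField_galois (sub1v _).
rewrite /trFp; case: pickP => [c /eqP // | noc].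
have /vlineP[c cP] : galTrace 1 {:L} (x : L) \in 1%VS.
  by rewrite (mem_galTrace galL (memvf _)).
by have := noc c; rewrite cP eqxx.
Qed.

End AbsoluteTrace.

Section MatrixKloosterman.
Variable R : realType.

Definition cexp (z : R[i]) : R[i] :=
  (expR (complex.Re z))%:C * (cos (complex.Im z) +i* sin (complex.Im z)).

Variables (F : finFieldType) (p : nat) (pcharFp : p \in [pchar F]).

(* [trFp pcharFp x : 'F_p] is used through its representative in {0, ..., p-1}. *)
Definition addchar (x : F) : R[i] :=
  cexp (2 * pi%:C * 'i%C * (trFp pcharFp x : nat)%:R / p%:R).

Definition mxchar (n : nat) (A : 'M[F]_n) : R[i] := addchar (\tr A).

Definition kloosterman (n : nat) (a : 'M[F]_n) : R[i] :=
  \sum_(x : 'M[F]_n | x \in unitmx) mxchar (a *m x + invmx x).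

End MatrixKloosterman.

(* Main.v *)
Require Import Defs.
From mathcomp Require Import all_boot all_order all_fingroup all_algebra.
From mathcomp Require Import all_field.
From mathcomp Require Import reals sequences exp trigo complex.
From mathcomp Require Import ring.

Set Implicit Arguments.
Unset Strict Implicit.

Import Order.TTheory GRing.Theory Num.Theory.
Local Open Scope ring_scope.

(** Write q for the order of F and chi for a nontrivial additive character.
    Replacing x by its inverse turns K_n(a) into the sum of
    chi (tr (a y^-1) + tr y) over invertible y ([kloosterman_klsum]); it
    depends only on the conjugacy class of a ([klsum_conj]).

    A nilpotent a of size n+1 kills some nonzero row vector on the left, so
    after conjugation its first row is zero: a = [[0, 0], [b, a']] with a'
    nilpotent ([nilpotent_conj_block]). The shears u = [[1, 0], [w, 1]] then
    satisfy u a = a, hence also u^-1 a = a, so the substitution y -> u y leaves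
    tr (a y^-1) unchanged and adds w y12 to the trace of y, where y12 is the top
    right block of y. Averaging over all columns w therefore kills every y with
    y12 <> 0. The remaining y are lower block triangular, y = [[c, 0], [z, d]]
    with c <> 0 and d invertible, and for them the summand is
    chi c * chi (tr (a' d^-1) + tr d). The sum over c is -1, the free column z
    contributes q^n, and so K_(n+1)(a) = - q^n K_n(a')
    ([klsum_block_step]). Induction on n gives (-1)^n q^(n(n-1)/2) for every
    nilpotent a, the zero matrix included ([klsum_nilpotent]).

    This uses only that chi is a nontrivial character with values in an
    integral domain of characteristic 0. For the character of the statement,
    chi x = zeta ^+ Tr x with zeta = exp(2 pi i / p), nontriviality amounts to
    the trace to the prime field being nonzero, which is a case of the linear
    independence of automorphisms, together with zeta <> 1. *)

(** * Character sums over matrices *)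

Lemma mulmx1_invmx (R : comUnitRingType) n (A B : 'M[R]_n) :
  A *m B = 1%:M -> invmx A = B.
Proof.
move=> AB1; have [AU _] := mulmx1_unit AB1.
by rewrite -[RHS](mulKmx AU) AB1 mulmx1.
Qed.

Section MatrixSums.
Variables (F : finFieldType) (C : numDomainType) (chi : F -> C).

Definition nontrivial_char :=
  [/\ chi 0 = 1, {morph chi : x y / x + y >-> x * y} & exists t, chi t != 1].

(** The matrix Kloosterman sum after the substitution y = x^-1; here the linear
    change of variables y -> u y acts on the term that does not involve a. *)
Definition klsum n (a : 'M[F]_n) : C :=
  \sum_(y : 'M[F]_n | y \in unitmx) chi (\tr (a *m invmx y) + \tr y).

Lemma klsum_conj n (g a : 'M[F]_n) :
  g \in unitmx -> klsum (g *m a *m invmx g) = klsum a.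
Proof.
move=> gU; pose conj (y : 'M_n) := g *m y *m invmx g.
have conjI : injective conj.
  move=> y z /(congr1 (fun w => invmx g *m w *m g)).
  by rewrite /conj !mulmxA !mulVmx // !mul1mx -!mulmxA !mulVmx // !mulmx1.
have trJ y : \tr (conj y) = \tr y.
  by rewrite /conj mxtrace_mulC mulmxA mulVmx // mul1mx.
have conjU y : (conj y \in unitmx) = (y \in unitmx).
  by rewrite !unitmx_mul unitmx_inv gU andbT.
rewrite /klsum (reindex_inj conjI) /=.
apply: eq_big => // y; rewrite conjU => yU.
rewrite trJ; congr (chi (_ + _)); rewrite -(trJ (a *m invmx y)); congr (\tr _).
have -> : invmx (conj y) = conj (invmx y).
  apply: mulmx1_invmx.
  by rewrite /conj !mulmxA mulmxKV // mulmxK // mulmxV // mulmx1.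
by rewrite /conj !mulmxA mulmxKV.
Qed.

Hypothesis chiP : nontrivial_char.

(** Translating the variable by t multiplies the sum by chi t <> 1. *)
Lemma sum_char : \sum_x chi x = 0.
Proof.
have [_ chiD [t chit]] := chiP.
have : (1 - chi t) * \sum_x chi x = 0.
  rewrite mulrBl mul1r mulr_sumr {1}(reindex_inj (addrI t)) /=.
  by apply/eqP; rewrite subr_eq0; apply/eqP/eq_bigr => x _.
by move/eqP; rewrite mulf_eq0 subr_eq0 eq_sym (negPf chit) => /eqP.
Qed.

Lemma sum_char_neq0 : \sum_(x | x != 0) chi x = -1.
Proof.
have [chi0 _ _] := chiP; have := sum_char.
by rewrite (bigD1 0) //= chi0 => /eqP; rewrite addrC addr_eq0 => /eqP.
Qed.

(** Orthogonality of characters on column vectors: if v j <> 0, translating w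
    by a suitable multiple of the j-th unit vector multiplies the sum by
    chi t <> 1. *)
Lemma sum_char_dual n (v : 'rV[F]_n) :
  \sum_(w : 'cV[F]_n) chi (\tr (w *m v)) =
  if v == 0 then #|F|%:R ^+ n else 0.
Proof.
have [chi0 chiD [t chit]] := chiP.
have [-> | v_neq0] := eqVneq v 0.
  rewrite (eq_bigr (fun=> 1)) => [|w _]; last by rewrite mulmx0 mxtrace0.
  by rewrite sumr_const card_mx muln1 natrX.
have [j vj] : exists j, v 0 j != 0.
  apply/existsP; apply: contraR v_neq0; rewrite negb_exists => /forallP v0.
  by apply/eqP/rowP=> j; rewrite mxE; have := v0 j; rewrite negbK => /eqP.
pose w0 : 'cV[F]_n := (t / v 0 j) *: delta_mx j 0.
have trw0 : \tr (w0 *m v) = t.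
  rewrite -scalemxAl mxtraceZ mxtrace_mulC -colE trace_mx11 mxE.
  by rewrite divfK.
have : (1 - chi t) * \sum_(w : 'cV[F]_n) chi (\tr (w *m v)) = 0.
  rewrite mulrBl mul1r mulr_sumr {1}(reindex_inj (addrI w0)) /=.
  apply/eqP; rewrite subr_eq0; apply/eqP/eq_bigr => w _.
  by rewrite mulmxDl mxtraceD chiD trw0.
by move/eqP; rewrite mulf_eq0 subr_eq0 eq_sym (negPf chit) => /eqP.
Qed.

(** The shear u = [[1, 0], [w, 1]] fixes every matrix whose first row is zero,
    so substituting u y for y changes only the term tr y, by tr (w y12). *)
Lemma klsum_shear n (b : 'cV[F]_n) (a : 'M[F]_n) (w : 'cV[F]_n) :
  klsum (block_mx 0 0 b a : 'M_(1 + n)) =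
  \sum_(y : 'M[F]_(1 + n) | y \in unitmx)
    chi (\tr (block_mx 0 0 b a *m invmx y) + \tr y) *
    chi (\tr (w *m ursubmx y)).
Proof.
have [_ chiD _] := chiP.
pose u : 'M[F]_(1 + n) := block_mx 1%:M 0 w 1%:M.
have uU : u \in unitmx by rewrite unitmxE det_lblock !det1 mulr1 unitr1.
have umulI : injective (fun y : 'M[F]_(1 + n) => u *m y).
  by move=> y z /(congr1 (mulmx (invmx u))); rewrite !mulKmx.
rewrite /klsum (reindex_inj umulI) /=; apply: eq_big => [y|y yU].
  by rewrite unitmx_mul uU.
move: yU; rewrite unitmx_mul uU => /= yU.
rewrite -chiD -addrA; congr (chi (_ + _)).
  set A := block_mx 0 0 b a.
  have uA : u *m A = A.
    by rewrite mulmx_block !mulmx0 !mul0mx !mul1mx !addr0 !add0r.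
  have -> : invmx (u *m y) = invmx y *m invmx u.
    apply: mulmx1_invmx.
    by rewrite !mulmxA mulmxK // mulmxV // mulmx1.
  rewrite mulmxA mxtrace_mulC mulmxA; congr (\tr (_ *m _)).
  by rewrite -{1}uA mulKmx.
rewrite -(submxK y) mulmx_block !mxtrace_block block_mxKur.
by rewrite !mul1mx !mul0mx !addr0 mxtraceD [\tr (w *m _) + _]addrC addrA.
Qed.

(** Averaging [klsum_shear] over w restricts the sum to the y whose top right
    block vanishes, where it factors. *)
Lemma klsum_block_step n (b : 'cV[F]_n) (a : 'M[F]_n) :
  klsum (block_mx 0 0 b a : 'M_(1 + n)) = - #|F|%:R ^+ n * klsum a.
Proof.
have [chi0 chiD _] := chiP.
have q_neq0 : #|F|%:R ^+ n != 0 :> C.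
  by rewrite expf_neq0 // pnatr_eq0 -lt0n; apply/card_gt0P; exists 0.
(* Multiplied by q^n, the left side is a sum over all shears w, to which
   orthogonality applies. *)
apply: (mulfI q_neq0).
have -> : #|F|%:R ^+ n * klsum (block_mx 0 0 b a : 'M_(1 + n)) =
    \sum_(w : 'cV[F]_n) klsum (block_mx 0 0 b a : 'M_(1 + n)).
  by rewrite sumr_const card_mx muln1 -natrX mulr_natl.
rewrite (eq_bigr _ (fun w _ => klsum_shear b a w)).
rewrite exchange_big /=.
under eq_bigr do rewrite -mulr_sumr sum_char_dual fun_if mulr0.
rewrite -big_mkcondr /= -mulr_suml mulrC; congr (_ * _).
(* The invertible y with zero top right block, in coordinates. *)
pose blk (t : F * ('cV[F]_n * 'M[F]_n)) : 'M[F]_(1 + n) :=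
  block_mx t.1%:M 0 t.2.1 t.2.2.
pose unblk (y : 'M[F]_(1 + n)) := (ulsubmx y 0 0, (dlsubmx y, drsubmx y)).
rewrite (reindex_onto blk unblk) => [|y /andP[_ /eqP y12]]; last first.
  by rewrite -[RHS]submxK y12 /blk /= -mx11_scalar.
have blkK t : unblk (blk t) == t.
  case: t => c [z d]; rewrite /unblk /blk.
  by rewrite block_mxKul block_mxKdl block_mxKdr mxE eqxx mulr1n.
rewrite (eq_bigl (fun t => (t.1 != 0) && (t.2.2 \in unitmx))); last first.
  move=> [c [z d]]; rewrite blkK andbT /blk block_mxKur eqxx andbT /=.
  by rewrite !unitmxE det_lblock det_scalar1 unitrM unitfE.
rewrite (eq_bigr (fun t =>
  chi t.1 * chi (\tr (a *m invmx t.2.2) + \tr t.2.2))); last first.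
  move=> [c [z d]] /andP[/= c_neq0 dU].
  have -> : invmx (blk (c, (z, d))) =
      block_mx (c^-1)%:M 0 (- (c^-1 *: (invmx d *m z))) (invmx d).
    apply: mulmx1_invmx; rewrite mulmx_block !mulmx0 !mul0mx !addr0 !add0r.
    rewrite -scalar_mxM divff // mulmxV // mul_mx_scalar mulmxN -scalemxAr.
    by rewrite mulmxA mulmxV // mul1mx subrr -scalar_mx_block.
  rewrite mulmx_block !mul0mx !mulmx0 !mxtrace_block addr0 mxtrace0 !add0r.
  by rewrite -chiD addrCA trace_mx11 mxE eqxx mulr1n.
(* The sum is now a product of independent sums over c, z and d. *)
rewrite -(pair_big_dep (fun c => c != 0) (fun c t => t.2 \in unitmx)
  (fun c t => chi c * chi (\tr (a *m invmx t.2) + \tr t.2))) /=.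
under eq_bigr do rewrite -mulr_sumr.
rewrite -mulr_suml sum_char_neq0 mulN1r mulNr; congr (- _).
rewrite -(pair_big_dep xpredT (fun _ d => d \in unitmx)
  (fun _ d => chi (\tr (a *m invmx d) + \tr d))) /=.
by rewrite sumr_const card_mx muln1 -natrX mulr_natl.
Qed.

End MatrixSums.

(** * Nilpotent matrices up to conjugation *)

Lemma block_mx_expr (K : fieldType) n (b : 'cV[K]_n) (a : 'M[K]_n) k :
  exists c d, (block_mx 0 0 b a : 'M_(1 + n)) ^+ k = block_mx c 0 d (a ^+ k).
Proof.
elim: k => [|k [c [d IHk]]].
  by exists 1%:M, 0; rewrite !expr0 -scalar_mx_block.
exists 0, (a ^+ k *m b); rewrite exprSr IHk -mulmxE mulmx_block.
by rewrite !mulmx0 !mul0mx !addr0 !add0r (exprSr a).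
Qed.

(** A singular matrix kills a nonzero row vector v; a basis of the row vectors
    that starts with a multiple of v conjugates it to one with zero first
    row. *)
Lemma nilpotent_conj_block (K : fieldType) n (a : 'M[K]_(1 + n)) k :
  a ^+ k = 0 ->
  exists (g : 'M[K]_(1 + n)) (b : 'cV_n) (a' : 'M_n),
    [/\ g \in unitmx, g *m a *m invmx g = block_mx 0 0 b a' & a' ^+ k = 0].
Proof.
move=> ak0.
have /det0P[v v_neq0 va0] : \det a == 0.
  apply: contraT => deta; suff : a ^+ k \is a GRing.unit by rewrite ak0 unitr0.
  by apply: unitrX; rewrite -[_ \is a _]/(a \in unitmx) unitmxE unitfE.
(* As v has rank 1, its extended row basis is an invertible matrix whose first
   row is a scalar multiple of v. *)
pose g : 'M[K]_(1 + n) := row_ebase v.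
have gU : g \in unitmx := row_ebase_unit v.
have usg0 : usubmx (g *m a) = 0.
  have := mulmx_ebase v; rewrite rank_rV v_neq0 -/g (pid_mx_row _ n 1) => gv.
  apply: (can_inj (mulKmx (col_ebase_unit v))); rewrite mulmx0.
  rewrite -[RHS]va0 -[X in _ = X *m a]gv -!mulmxA; congr (_ *m _).
  by rewrite -[in RHS](vsubmxK (g *m a)) mul_row_col mul1mx mul0mx addr0.
pose c : 'M[K]_(1 + n) := g *m a *m invmx g.
exists g, (dlsubmx c), (drsubmx c).
have cE : c = block_mx 0 0 (dlsubmx c) (drsubmx c).
  have us : usubmx c = 0.
    by rewrite /c -[g *m a]vsubmxK mul_col_mx col_mxKu usg0 mul0mx.
  by rewrite -[LHS]submxK /ulsubmx /ursubmx us linear0 linear0.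
split=> //.
have ck0 : c ^+ k = 0.
  suff -> : c ^+ k = g *m a ^+ k *m invmx g by rewrite ak0 mulmx0 mul0mx.
  elim: (k) => [|m IHm]; first by rewrite !expr0 mulmx1 mulmxV.
  by rewrite exprSr IHm -mulmxE /c !mulmxA mulmxKV // exprSr -mulmxE !mulmxA.
have [x [y]] := block_mx_expr (dlsubmx c) (drsubmx c) k.
by rewrite -cE ck0 -(block_mx0 _ 1 n 1 n) => /eq_block_mx[].
Qed.


Lemma klsum_nilpotent (F : finFieldType) (C : numDomainType) (chi : F -> C)
    (chiP : nontrivial_char chi) n (a : 'M[F]_n) k :
  a ^+ k = 0 -> klsum chi a = (-1) ^+ n * #|F|%:R ^+ 'C(n, 2).
Proof.
elim: n a => [|n IHn] a ak0.
  have [chi0 _ _] := chiP.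
  rewrite /klsum (bigD1 0) /=; last by rewrite unitmxE det_mx00 unitr1.
  rewrite big1 => [|y /andP[_ /eqP[]]]; last by apply/matrixP=> -[].
  by rewrite (flatmx0 a) mul0mx !mxtrace0 !addr0 chi0 mulr1.
have [g [b [a' [gU gE a'k0]]]] := nilpotent_conj_block ak0.
rewrite -(klsum_conj chi (a : 'M_(1 + n)) gU) gE.
rewrite klsum_block_step // (IHn _ a'k0).
by rewrite binS bin1 addnC exprD exprS; ring.
Qed.

(** * The character exp(2 pi i Tr(x) / p) *)

Section StandardCharacter.
Variables (R : realType) (F : finFieldType) (p : nat).
Variable pcharFp : p \in [pchar F].

Let L : splittingFieldType 'F_p := pPrimeCharType pcharFp.

Lemma cexpD : {morph @cexp R : z w / z + w >-> z * w}.
Proof.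
move=> [a b] [c d]; rewrite /cexp /= expRD cosD sinD.
by apply/eqP; rewrite eq_complex /=; apply/andP; split; apply/eqP; ring.
Qed.

Lemma cexpMn z k : @cexp R (z *+ k) = cexp z ^+ k.
Proof.
elim: k => [|k IHk]; last by rewrite mulrS cexpD IHk exprS.
by rewrite mulr0n expr0 /cexp /= expR0 cos0 sin0 mul1r.
Qed.

Lemma trFpD : {morph trFp pcharFp : x y / x + y}.
Proof.
move=> x y; apply: (fmorph_inj (in_alg L)) => /=.
by rewrite scalerDl !trFpE -raddfD.
Qed.

(** If the trace vanished identically, the automorphisms of F over its prime
    field would be linearly dependent. *)
Lemma trFp_neq0 : exists x, trFp pcharFp x != 0.
Proof.
apply/existsP; apply: contraT; rewrite negb_exists => /forallP tr0.
have /(gal_independent (P := [in 'Gal({:L} / 1)%g])) : 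
  forall a : L, a \in {:L}%VS -> \sum_(x in 'Gal({:L} / 1)%g) 1 * x a = 0.
  move=> a _; have := tr0 a; rewrite negbK => /eqP tra0.
  under eq_bigr do rewrite mul1r.
  by rewrite -[LHS](trFpE pcharFp a) tra0 scale0r.
by move=> /(_ 1%g (group1 _)) /eqP; rewrite oner_eq0.
Qed.

Lemma addchar_exp x :
  addchar R pcharFp x = cexp (2 * (pi%:C)%C * 'i%C / p%:R) ^+ trFp pcharFp x.
Proof. by rewrite /addchar mulrAC mulr_natr cexpMn. Qed.

Let theta : R := 2 * pi / p%:R.
Let zeta : R[i] := cexp (2 * (pi%:C)%C * 'i%C / p%:R).

Let pP : prime p := pcharf_prime pcharFp.

Lemma zeta_argE : 2 * (pi%:C)%C * 'i%C / p%:R = (0 +i* theta)%C :> R[i].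
Proof.
have p0 : p%:R != 0 :> R by rewrite pnatr_eq0 -lt0n prime_gt0.
apply: (mulIf (x := p%:R)); first by rewrite pnatr_eq0 -lt0n prime_gt0.
rewrite divfK ?pnatr_eq0 -?lt0n ?prime_gt0 //.
rewrite -!(rmorph_nat (real_complex R)) /=.
by apply/eqP; rewrite eq_complex /= /theta; apply/andP; split; apply/eqP; field.
Qed.

Lemma zetaXp : zeta ^+ p = 1.
Proof.
rewrite /zeta zeta_argE -cexpMn -mulr_natr -(rmorph_nat (real_complex R)).
have -> : (0 +i* theta)%C * real_complex R p%:R = (0 +i* (2 * pi))%C.
  have p0 : p%:R != 0 :> R by rewrite pnatr_eq0 -lt0n prime_gt0.
  by apply/eqP; rewrite eq_complex /= /theta; apply/andP; split; apply/eqP; field.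
rewrite /cexp /= expR0 mul1r mulr_natl mulr2n.
by rewrite cosDpi cospi sinDpi sinpi opprK oppr0.
Qed.

Lemma zeta_neq1 : zeta != 1.
Proof.
apply/eqP; rewrite /zeta zeta_argE /cexp /= expR0 mul1r => -[costh _].
have p0 : 0 < p%:R :> R by rewrite ltr0n prime_gt0.
have th_gt0 : 0 < theta by rewrite divr_gt0 // mulr_gt0 // pi_gt0.
have th_le : theta <= pi.
  by rewrite ler_pdivrMr // mulrC ler_pM2l ?pi_gt0 // ler_nat prime_gt1.
have /eqP : theta = 0.
  by apply: cos_inj; rewrite ?cos0 // in_itv /= ?lexx ?pi_ge0 // ltW.
by rewrite gt_eqF.
Qed.

(** Since zeta ^+ p = 1, exponents may be reduced mod p, which makes the integer
    representatives of traces additive. If Tr x = c <> 0, then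
    zeta ^+ c = 1 would give zeta = zeta ^+ (c * c^-1) = 1. *)
Lemma addchar_nontrivial : nontrivial_char (addchar R pcharFp).
Proof.
have zeta_mod m : zeta ^+ (m %% p) = zeta ^+ m := expr_mod m zetaXp.
split.
- rewrite addchar_exp -/zeta.
  suff -> : trFp pcharFp 0 = 0 by [].
  by apply: (addrI (trFp pcharFp 0)); rewrite -trFpD !addr0.
- move=> x y; rewrite !addchar_exp -/zeta -exprD trFpD /=.
  rewrite -[RHS]zeta_mod; congr (zeta ^+ (_ %% _)).
  exact: Fp_cast.
have [x trx] := trFp_neq0; exists x; rewrite addchar_exp -/zeta.
apply: contraNneq zeta_neq1 => zc1.
pose c := trFp pcharFp x.
have cm : ((c * c^-1%R) %% p = 1)%N.
  have <- : val (c * c^-1) = 1%N by rewrite divff.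
  by congr (_ %% _)%N; rewrite Fp_cast.
by rewrite -[zeta]expr1 -cm zeta_mod exprM zc1 expr1n.
Qed.

Lemma kloosterman_klsum n (a : 'M[F]_n) :
  kloosterman R pcharFp a = klsum (addchar R pcharFp) a.
Proof.
rewrite /kloosterman /klsum (reindex_inj (can_inj invmxK)) /=.
apply: eq_big => y; first by rewrite unitmx_inv.
by rewrite /mxchar invmxK mxtraceD.
Qed.

End StandardCharacter.

(** * Nilpotent Kloosterman sums *)

Theorem theorem1p2 (R : realType) (F : finFieldType) (p : nat)
  (pcharFp : p \in [pchar F]) (n : nat) (a : 'M[F]_n)
  (nilp_a : exists k : nat, a ^+ k = 0) :
  kloosterman R pcharFp a = kloosterman R pcharFp (0 : 'M[F]_n) /\
  kloosterman R pcharFp (0 : 'M[F]_n) =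
    (-1) ^+ n * (#|F|%:R) ^+ (n * (n - 1) %/ 2)%N.
Proof.
have [k ak0] := nilp_a; have chiP := addchar_nontrivial R pcharFp.
rewrite !kloosterman_klsum (klsum_nilpotent chiP ak0).
rewrite (klsum_nilpotent chiP (expr1 (0 : 'M[F]_n))).
by rewrite divn2 subn1 bin2.
Qed.
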